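(* Let $\Bbbk\subset L$ be a separable extension of fields and let $f\in\Bbbk[x_1,\dots,x_n]\setminus\Bbbk$. Then $f$ is closed over $\Bbbk$ if and only if $f$ is closed over $L$.
   Context: For a field $K$, a polynomial $f\in K[x_1,\dots,x_n]\setminus K$ is closed over $K$ if the subalgebra $K[f]$ is integrally closed in $K[x_1,\dots,x_n]$. The separable extension $\Bbbk\subset L$ is not required to be algebraic: separability is in the general sense, so that every finitely generated subextension of $L$ over $\Bbbk$ has a finite separating transcendence basis over $\Bbbk$. *)

(* Defs.v *)
From HB Require Import structures.
From mathcomp Require Import all_boot all_order all_algebra all_field.
From mathcomp Require Export mpoly.

Set Implicit Arguments.
Unset Strict Implicit.
Unset Printing Implicit Defensive.

Import GRing.Theory.
Local Open Scope ring_scope.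

Section ClosedPolynomials.

Variables (K : fieldType) (n : nat).
Implicit Types f g : {mpoly K[n]}.

Definition in_subalg f g : Prop := exists q : {poly K}, g = horner_alg f q.

(* [integralOver (horner_alg f)] is integrality over the image of              *)
(* [horner_alg f : {poly K} -> {mpoly K[n]}], which is the subalgebra K[f].    *)
(* The requirement that f be nonconstant is not included here.                 *)
Definition closed_mpoly f : Prop :=
  forall g, integralOver (horner_alg f) g -> in_subalg f g.

End ClosedPolynomials.

Section Separability.

Variables (k L : fieldType) (iota : {rmorphism k -> L}).

(* Subfields of L are Prop-valued predicates: L may have infinite degree       *)
(* over k, and membership in a subfield need not be decidable.                 *)
Record is_subfield (F : L -> Prop) : Prop := IsSubfield {
  subfield1 : F 1;
  subfieldB : forall x y, F x -> F y -> F (x - y);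
  subfield_div : forall x y, F x -> F y -> F (x / y) }.

(* k(s), the smallest subfield of L containing iota(k) and s. *)
Definition adjoin (s : seq L) (z : L) : Prop :=
  forall F : L -> Prop, is_subfield F ->
    (forall a : k, F (iota a)) -> (forall x, x \in s -> F x) -> F z.

Definition poly_over (F : L -> Prop) (p : {poly L}) : Prop :=
  forall i, F p`_i.

Definition is_minpoly (F : L -> Prop) (z : L) (p : {poly L}) : Prop :=
  [/\ p \is monic, poly_over F p, root p z
    & forall q, poly_over F q -> q != 0 -> root q z -> (size p <= size q)%N].

Definition separable_algebraic (F : L -> Prop) (z : L) : Prop :=
  exists2 p, is_minpoly F z p & separable_poly p.

(* As t is a sequence, independence also forces its entries to be distinct. *)
Definition alg_independent (t : seq L) : Prop :=
  forall p : {mpoly k[size t]}, mmap iota (fun i => t`_i) p = 0 -> p = 0.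

Definition separating_transcendence_basis (E : L -> Prop) (t : seq L) : Prop :=
  [/\ forall x, x \in t -> E x, alg_independent t
    & forall z, E z -> separable_algebraic (adjoin t) z].

Definition separable_extension : Prop :=
  forall s : seq L, exists t : seq L,
    separating_transcendence_basis (adjoin s) t.

End Separability.

(* Main.v *)
Require Import Defs.
From HB Require Import structures.
From mathcomp Require Import all_boot all_order all_algebra all_field.
From mathcomp Require Import generic_quotient ring.
From Stdlib Require Import Classical.

(** Integral closure commutes with separable extension of scalars: if [g] over
    [L] is integral over [L[f]], then [g] is an [L]-linear combination of
    polynomials over [k] integral over [k[f]] ([separable_descends]).  When [f]
    is closed over [k], these polynomials lie in [k[f]], and [g] lies in
    [L[f]].

    The property is stable under towers of extensions
    ([integral_descends_comp]).  The coefficients of [g] and of an integral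
    equation of [g] lie in a finitely generated extension of [k], hence in a
    tower consisting of a field of rational functions [k(t)] followed by simple
    separable extensions.  Each step is handled by specialization.  Write
    [g = sum_b e_b h_b] with [h_b] over the small field and [e_b] in a ring [A]
    of polynomials, and choose ring morphisms from [A] to a field [M] integral
    over the small field, killing whatever vanishes in the large field.  They
    carry the integral equation of [g] over, so the values
    [sum_b psi(e_b) h_b] are integral over [M[f]].  When the morphism number
    [i] maps [e_b] to [c_i ^ kappa(b)], for distinct points [c_i] and distinct
    exponents [kappa(b)], inverting a Vandermonde matrix shows that each [h_b]
    is integral over [M[f]], hence over the polynomials in [f] with
    coefficients in the small field ([integral_coefficients]).

    - In a simple separable extension [E(theta)] the [e_b] are the powers of
      the variable of [E[X]], and the [c_i] are the conjugates of [theta];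
      separability provides as many distinct conjugates as powers
      ([separable_simple_descends]).
    - In [k(t)] one first clears denominators.  The [e_b] are then the
      monomials in [t], and the Kronecker substitution [t_l := c ^ (B ^ l)]
      sends distinct monomials of small degree to distinct powers of [c]; the
      points [c] are roots of unity, so that finite fields need no special
      treatment ([fraction_descends]).

    Conversely, if [f] is closed over [L] and [g] is integral over [k[f]], then
    [g] is a combination of powers of [f] over [L]; this is a linear system
    with coefficients in [k], so it is solvable over [k]
    ([closed_mpoly_descends]). *)

Set Implicit Arguments.
Unset Strict Implicit.
Unset Printing Implicit Defensive.

Import GRing.Theory.
Local Open Scope ring_scope.

(** * Change of coefficients in multivariate polynomials *)

(** A restatement for ring morphisms, whose coefficients then stay in the form in
    which hypotheses on [a] are stated. *)
Lemma mcoeff_map_rmorph (n : nat) (R S : comNzRingType) (a : {rmorphism R -> S})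
    (p : {mpoly R[n]}) (m : 'X_{1..n}) :
  (map_mpoly a p)@_m = a p@_m.
Proof. exact: mcoeff_map_mpoly. Qed.

(** The composite is given by its values, so that it may be any morphism known to
    agree with [b \o a] pointwise. *)
Lemma map_mpoly_comp_eq (n : nat) (R S T : comNzRingType) (a : {rmorphism R -> S})
    (b : {rmorphism S -> T}) (c : {rmorphism R -> T}) (p : {mpoly R[n]}) :
  (forall x, b (a x) = c x) -> map_mpoly b (map_mpoly a p) = map_mpoly c p.
Proof. by move=> abc; apply/mpolyP => m; rewrite !mcoeff_map_rmorph abc. Qed.

Lemma horner_alg_mpolyC (n : nat) (R : comNzRingType) (f : {mpoly R[n]}) (c : R) :
  horner_alg f c%:P = c%:MP.
Proof. by rewrite horner_algC alg_mpolyC. Qed.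

Lemma map_horner_alg (n : nat) (R S : comNzRingType) (a : {rmorphism R -> S})
    (f : {mpoly R[n]}) (q : {poly R}) :
  map_mpoly a (horner_alg f q) = horner_alg (map_mpoly a f) (map_poly a q).
Proof.
elim/poly_ind: q => [|q c IHq]; first by rewrite !rmorph0.
rewrite !(rmorphD, rmorphM) /= map_polyX map_polyC !horner_algX !horner_algC.
by rewrite IHq map_mpolyZ rmorph1.
Qed.

Lemma map_mpoly_inj (n : nat) (R S : comNzRingType) (a : {rmorphism R -> S}) :
  injective a -> injective (map_mpoly a : {mpoly R[n]} -> {mpoly S[n]}).
Proof.
move=> a_inj p q /mpolyP eq_pq; apply/mpolyP => m; apply: a_inj.
by rewrite -!mcoeff_map_rmorph.
Qed.

Lemma map_mpoly_idfun (n : nat) (R : comNzRingType) (p : {mpoly R[n]}) :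
  map_mpoly (idfun : {rmorphism R -> R}) p = p.
Proof. by apply/mpolyP => m; rewrite mcoeff_map_rmorph. Qed.

Lemma horner_alg_sum (n : nat) (R : comNzRingType) (f : {mpoly R[n]}) (q : {poly R}) N :
  (size q <= N)%N -> horner_alg f q = \sum_(i < N) q`_i *: f ^+ i.
Proof.
move=> sq; rewrite /horner_alg /horner_morph (@horner_coef_wide _ N).
  by apply: eq_bigr => i _; rewrite coef_map /= mulr_algl.
by rewrite (leq_trans _ sq) // size_poly.
Qed.

(** Membership of coefficients is asked one at a time, so that no choice is needed
    to collect the decompositions into polynomials. *)
Lemma mpoly_decompose (n : nat) (R S : comNzRingType) (a : {rmorphism R -> S})
    (I : finType) (e : I -> S) (g : {mpoly S[n]}) :
  (forall m, exists r : I -> R, g@_m = \sum_i e i * a (r i)) ->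
  exists h : I -> {mpoly R[n]}, g = \sum_i e i *: map_mpoly a (h i).
Proof.
elim/mpolyind: g => [_ | x m g gm nz_x IHg gE].
  by exists (fun=> 0); rewrite big1 // => i _; rewrite rmorph0 scaler0.
have [|h Dh] := IHg => [m'|].
  have [-> | ne_mm'] := eqVneq m' m; last first.
    by have := gE m'; rewrite mcoeffD mcoeffZ mcoeffX eq_sym (negPf ne_mm') mulr0 add0r.
  exists (fun=> 0); rewrite memN_msupp_eq0 // big1 // => i _.
  by rewrite rmorph0 mulr0.
have [r Dr] := gE m; rewrite mcoeffD mcoeffZ mcoeffX eqxx mulr1 in Dr.
rewrite (memN_msupp_eq0 gm) addr0 in Dr.
exists (fun i => r i *: 'X_[m] + h i); rewrite {1}Dr {1}Dh scaler_suml -big_split /=.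
apply: eq_bigr => i _; rewrite rmorphD scalerDr /=; congr (_ + _).
by rewrite map_mpolyZ map_mpolyX scalerA.
Qed.

Lemma poly_lift (R S : nzRingType) (a : {rmorphism R -> S}) (p : {poly S}) :
  (forall i, exists x, a x = p`_i) -> exists q, map_poly a q = p.
Proof.
elim/poly_ind: p => [|p x IHp] pa; first by exists 0; rewrite rmorph0.
have [|q Dq] := IHp.
  by move=> i; have [y Dy] := pa i.+1; exists y; rewrite Dy coefD coefMX coefC addr0.
have [y Dy] := pa 0%N; rewrite coefD coefMX coefC add0r in Dy.
by exists (q * 'X + y%:P); rewrite rmorphD rmorphM /= map_polyX map_polyC /= Dq Dy.
Qed.

(** The leading coefficient must be lifted to 1 exactly, also when the morphism is
    not injective: hence the correction of a first lift. *)
Lemma monic_lift (R S : nzRingType) (a : {rmorphism R -> S}) (p : {poly S}) :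
  p \is monic -> (forall i, exists x, a x = p`_i) ->
  exists2 q, q \is monic & map_poly a q = p.
Proof.
move=> p_monic pa; have [q Dq] := poly_lift pa.
pose d := (size p).-1; exists ('X^d + \poly_(i < d) q`_i).
  by rewrite monicE lead_coefDl ?size_polyXn ?ltnS ?size_poly // lead_coefXn.
apply/polyP => i; rewrite rmorphD /= map_polyXn coefD coefXn coef_map /= coef_poly.
have [lt_i | ge_i] := ltnP i d.
  by rewrite ltn_eqF // add0r -Dq coef_map.
rewrite raddf0 addr0; case: eqP => [-> | ne_i]; first exact/esym/monicP.
rewrite nth_default // -(prednK (_ : 0 < size p)%N).
  by rewrite ltn_neqAle ge_i andbT; apply/eqP/nesym.
by rewrite size_poly_gt0 monic_neq0.
Qed.

(** * Integral elements over the subalgebra of a polynomial *)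

Lemma integral_map (n : nat) (R S : comNzRingType) (a : {rmorphism R -> S})
    (f h : {mpoly R[n]}) :
  integralOver (horner_alg f) h ->
  integralOver (horner_alg (map_mpoly a f)) (map_mpoly a h).
Proof.
case=> P mP Ph; exists (map_poly (map_poly a) P); first exact: monic_map.
rewrite -map_poly_comp (eq_map_poly (g := map_mpoly a \o horner_alg f)).
  by rewrite map_poly_comp rmorph_root.
by move=> q /=; rewrite map_horner_alg.
Qed.

(** An integral equation lifted to [A] holds only up to polynomials whose
    coefficients lie in the kernel of [pi]; [psi] kills these too. *)
Lemma integral_specialize (n : nat) (A K M : comNzRingType)
    (pi : {rmorphism A -> K}) (psi : {rmorphism A -> M})
    (ker_sub : forall a, pi a = 0 -> psi a = 0)
    (f g : {mpoly A[n]}) (P : {poly {poly A}}) (P_monic : P \is monic)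
    (Pg : root (map_poly (horner_alg (map_mpoly pi f)) (map_poly (map_poly pi) P))
               (map_mpoly pi g)) :
  integralOver (horner_alg (map_mpoly psi f)) (map_mpoly psi g).
Proof.
have mapE (B : comNzRingType) (b : {rmorphism A -> B}) :
    (map_poly (horner_alg (map_mpoly b f)) (map_poly (map_poly b) P)).[map_mpoly b g]
    = map_mpoly b (map_poly (horner_alg f) P).[g].
  rewrite -horner_map -!map_poly_comp; congr horner; apply: eq_map_poly => q /=.
  by rewrite map_horner_alg.
exists (map_poly (map_poly psi) P); first exact: monic_map.
move: Pg; rewrite /root !mapE => /eqP/mpolyP Z.
apply/eqP/mpolyP => m; have := Z m; rewrite !mcoeff_map_rmorph !mcoeff0.
exact: ker_sub.
Qed.

Lemma integral_sum (R S : comNzRingType) (a : {rmorphism R -> S}) (I : finType)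
    (x : I -> S) :
  (forall i, integralOver a (x i)) -> integralOver a (\sum_i x i).
Proof.
move=> ax; apply: (big_ind (integralOver a)) => //; first exact: integral0.
exact: integral_add.
Qed.

Lemma integral_scale (n : nat) (R : comNzRingType) (f h : {mpoly R[n]}) (c : R) :
  integralOver (horner_alg f) h -> integralOver (horner_alg f) (c *: h).
Proof.
move=> fh; rewrite -mul_mpolyC -alg_mpolyC -(horner_algC f); apply: integral_mul => //.
exact: integral_id.
Qed.

(** Transitivity of integrality: over [k[f]], the element [f] is integral, so are
    the constants of [M], hence so is everything integral over [M[f]]. *)
Lemma integral_descend (n : nat) (k M : fieldType) (j : {rmorphism k -> M})
    (j_integral : integralRange j) (f h : {mpoly k[n]}) :
  integralOver (horner_alg (map_mpoly j f)) (map_mpoly j h) ->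
  integralOver (horner_alg f) h.
Proof.
pose rho : {rmorphism {poly k} -> {mpoly M[n]}} := map_mpoly j \o horner_alg f.
case=> P mP Ph.
have : integralOver rho (map_mpoly j h).
  apply: integral_root_monic Ph _; first exact: monic_map.
  apply/integral_poly => i; rewrite coef_map /=.
  have fi : integralOver rho (map_mpoly j f).
    by have := integral_id rho 'X; rewrite /= horner_algX.
  rewrite /horner_alg /horner_morph; apply: integral_horner fi.
  apply/integral_poly => l; rewrite coef_map /=.
  have [Q mQ Qc] := j_integral P`_i`_l.
  exists (map_poly polyC Q); first exact: monic_map.
  rewrite -map_poly_comp (eq_map_poly (g := in_alg _ \o j)).
    by rewrite map_poly_comp; exact: (rmorph_root (in_alg {mpoly M[n]})).
  move=> c /=; rewrite horner_algC map_mpolyZ rmorph1 //.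
case=> Q mQ; rewrite /= map_poly_comp => Qh; exists Q => //; move: Qh.
rewrite /root horner_map /= -(rmorph0 (map_mpoly j)).
by rewrite (inj_eq (map_mpoly_inj (fmorph_inj j))).
Qed.

(** * Interpolation and splitting fields *)

(** The weights form a column of the inverse of the Vandermonde matrix of the
    points. *)
Lemma interpolation_weights (M : fieldType) (m : nat) (c : 'I_m -> M)
    (c_inj : injective c) (l0 : 'I_m) :
  exists w : 'I_m -> M, forall l : 'I_m, \sum_i w i * c i ^+ l = (l == l0)%:R.
Proof.
pose V := Vandermonde m (\row_i c i).
have Vunit : V \in unitmx.
  rewrite unitmxE det_Vandermonde unitfE; apply/prodf_neq0 => i _.
  apply/prodf_neq0 => i' lt_ii'; rewrite !mxE subr_eq0 (inj_eq c_inj).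
  by rewrite -val_eqE gtn_eqF.
exists (fun i => (invmx V *m delta_mx l0 (0 : 'I_1)) i 0) => l.
have /matrixP/(_ l 0) := mulKVmx Vunit (delta_mx l0 (0 : 'I_1)).
rewrite !mxE eqxx andbT => <-; apply: eq_bigr => i _.
by rewrite [V _ _]mxE !mxE mulrC.
Qed.

Lemma ex_irreducible_divisor (k : fieldType) (p : {poly k}) :
  (1 < size p)%N -> exists2 q, irreducible_poly q & q %| p.
Proof.
have [N] := ubnP (size p); elim: N p => // N IH p ltpN p_gt1.
have p_neq0 : p != 0 by rewrite -size_poly_gt0 ltnW.
case: (classic (forall q : {poly k}, size q != 1 -> q %| p -> q %= p)) => [irr | nirr].
  by exists p.
have [q nq] := not_all_ex_not _ _ nirr.
have [q_neq1 nq'] := imply_to_and _ _ nq; have [qp nqp] := imply_to_and _ _ nq'.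
have q_neq0 : q != 0 by apply: contraTneq qp => ->; rewrite dvd0p.
have ltq : (size q < size p)%N.
  rewrite ltn_neqAle dvdp_leq // andbT; apply/negP => /eqP eqs.
  by apply: nqp; rewrite -dvdp_size_eqp // eqs.
have [||r irr_r rq] := IH q; first exact: leq_trans ltq _.
  by rewrite ltn_neqAle eq_sym q_neq1 size_poly_gt0.
by exists r => //; apply: dvdp_trans rq qp.
Qed.

Lemma fieldExt_integral (k : fieldType) (L : fieldExtType k) :
  integralRange (in_alg L).
Proof.
move=> x; have /polyOver1P[q Dq] := minPolyOver 1%VS x.
exists q; last by rewrite -Dq root_minPoly.
by rewrite -(map_monic (in_alg L)) -Dq monic_minPoly.
Qed.

Lemma integralRange_comp (k L M : comNzRingType) (a : {rmorphism k -> L})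
    (b : {rmorphism L -> M}) :
  integralRange a -> integralRange b -> integralRange (b \o a).
Proof.
move=> a_int b_int x; have [q mq qx] := b_int x.
apply: integral_root_monic qx _; first exact: monic_map.
apply/integral_poly => i; rewrite coef_map /=.
exact: (integral_rmorph b (a_int _)).
Qed.

(** Adjoin a root of an irreducible factor, divide by the linear factor, and
    repeat.  Only integrality of the elements of [M] is retained, since it is what
    lets integral equations over [M] descend to [k]. *)
Lemma ex_splitting_field (k : fieldType) (p : {poly k}) : p != 0 ->
  exists (M : fieldType) (j : {rmorphism k -> M}) (s : seq M),
    integralRange j /\ map_poly j p %= \prod_(c <- s) ('X - c%:P).
Proof.
have [N] := ubnP (size p); elim: N k p => // N IH k p ltpN p_neq0.
have [p_gt1 | p_le1] := ltnP 1 (size p); last first.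
  exists k, idfun, [::]; split; first by move=> x; apply: (integral_id idfun).
  rewrite big_nil map_poly_id // -size_poly_eq1 eqn_leq p_le1.
  by rewrite size_poly_gt0.
have [q irr_q qp] := ex_irreducible_divisor p_gt1.
have [L _ [z qz _]] := irredp_FAdjoin irr_q.
have pz : root (map_poly (in_alg L) p) z.
  by move: qp; rewrite -(dvdp_map (in_alg L)) => /dvdpP[r ->]; rewrite rootM qz orbT.
have /factor_theorem[r Dr] := pz.
have r_neq0 : r != 0.
  have : map_poly (in_alg L) p != 0 by rewrite map_poly_eq0.
  by rewrite Dr mulf_eq0 negb_or => /andP[].
have [|M [j [s [j_int Ds]]]] := IH L r _ r_neq0.
  move: ltpN; rewrite -(size_map_poly (in_alg L)) Dr size_Mmonic ?monicXsubC //.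
  by rewrite size_XsubC addn2.
exists M, (j \o in_alg L), (j z :: s); split.
  by apply: integralRange_comp j_int; apply: fieldExt_integral.
rewrite map_poly_comp /= Dr rmorphM /= rmorphB /= map_polyX map_polyC big_cons.
by rewrite mulrC eqp_mul2l // polyXsubC_eq0.
Qed.

Lemma ex_separable_splitting (k : fieldType) (p : {poly k}) : separable_poly p ->
  exists (M : fieldType) (j : {rmorphism k -> M}) (c : 'I_(size p).-1 -> M),
    [/\ integralRange j, injective c & forall i, root (map_poly j p) (c i)].
Proof.
move=> p_sep; have p_neq0 := separable_poly_neq0 p_sep.
have [M [j [s [j_int Ds]]]] := ex_splitting_field p_neq0.
have s_uniq : uniq s.
  by rewrite -separable_prod_XsubC -(eqp_separable Ds) separable_map.
have sz : size s = (size p).-1.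
  by rewrite -(size_map_poly j) (eqp_size Ds) size_prod_XsubC.
exists M, j, (fun i => s`_i); split=> //.
  by move=> i i' /eqP; rewrite nth_uniq ?sz // => /eqP/val_inj.
by move=> i; rewrite (eqp_root Ds) root_prod_XsubC mem_nth // sz.
Qed.

(** Roots of [X^m - 1], where [m] is taken invertible in [k]: of two consecutive
    integers, one is. *)
Lemma ex_many_points (k : fieldType) (N : nat) :
  exists (M : fieldType) (j : {rmorphism k -> M}) (m : nat) (c : 'I_m -> M),
    [/\ (N <= m)%N, integralRange j & injective c].
Proof.
have [m ltNm nz_m] : exists2 m, (N < m)%N & m%:R != 0 :> k.
  have [Nz | nz] := eqVneq (N.+1%:R : k) 0; last by exists N.+1.
  by exists N.+2; rewrite // mulrSr Nz add0r oner_neq0.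
have m_gt0 : (0 < m)%N by apply: leq_ltn_trans ltNm.
have szX : size ('X^m - 1 : {poly k}) = m.+1 by apply: size_XnsubC.
have sepX : separable_poly ('X^m - 1 : {poly k}).
  rewrite unlock derivB derivXn derivC subr0.
  rewrite -scaler_nat coprimepZr // /coprimep.
  rewrite -(prednK m_gt0) exprS.
  (* X * X^(m-1) - (X^m - 1) = 1, with X^(m-1) the derivative up to a unit. *)
  apply/Bezout_eq1_coprimepP; exists (-1, 'X) => /=.
  by rewrite mulN1r opprB subrK.
have [M [j [c [j_int c_inj _]]]] := ex_separable_splitting sepX.
by exists M, j, _, c; split; rewrite // szX ltnW.
Qed.

(** * Descent of integral elements *)

(** The linear span, as the intersection of all subspaces containing [S]: to show
    that its elements have a property it suffices to apply the span to it, and no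
    finite families have to be handled. *)
Definition spanned (K : fieldType) (V : lmodType K) (S : V -> Prop) (v : V) : Prop :=
  forall W : V -> Prop, W 0 -> (forall a x y, W x -> W y -> W (a *: x + y)) ->
    (forall x, S x -> W x) -> W v.

Lemma spanned_mem (K : fieldType) (V : lmodType K) (S : V -> Prop) v : S v -> spanned S v.
Proof. by move=> Sv W _ _; apply. Qed.

Lemma spannedZD (K : fieldType) (V : lmodType K) (S : V -> Prop) a u v :
  spanned S u -> spanned S v -> spanned S (a *: u + v).
Proof. by move=> Su Sv W W0 WD WS; exact: WD (Su W W0 WD WS) (Sv W W0 WD WS). Qed.

Lemma spannedZ (K : fieldType) (V : lmodType K) (S : V -> Prop) a v :
  spanned S v -> spanned S (a *: v).
Proof. by move=> Sv; rewrite -[_ *: _]addr0; apply: spannedZD. Qed.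

Lemma spanned_sum (K : fieldType) (V : lmodType K) (S : V -> Prop)
    (I : finType) (x : I -> V) :
  (forall i, spanned S (x i)) -> spanned S (\sum_i x i).
Proof.
move=> Sx; apply: (big_ind (spanned S)) => // u v Su Sv.
by rewrite -[u]scale1r; apply: spannedZD.
Qed.

(** The integral closure of [K[f]] is generated over [K] by that of [k[f]].  The
    quantification over all [f] is what allows composition of extensions. *)
Definition integral_descends (k K : fieldType) (iota : {rmorphism k -> K}) : Prop :=
  forall (n : nat) (f : {mpoly k[n]}) (g : {mpoly K[n]}),
    integralOver (horner_alg (map_mpoly iota f)) g ->
    spanned (fun v => exists2 h, integralOver (horner_alg f) h & v = map_mpoly iota h) g.

Lemma integral_descends_id (k : fieldType) : integral_descends (idfun : {rmorphism k -> k}).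
Proof.
move=> n f g; rewrite map_mpoly_idfun => fg; apply: spanned_mem; exists g => //.
by rewrite map_mpoly_idfun.
Qed.

Lemma integral_descends_comp (k E K : fieldType) (iota : {rmorphism k -> E})
    (eta : {rmorphism E -> K}) :
  integral_descends iota -> integral_descends eta -> integral_descends (eta \o iota).
Proof.
move=> di de n f g.
have -> : map_mpoly (eta \o iota) f = map_mpoly eta (map_mpoly iota f).
  by rewrite (map_mpoly_comp_eq (c := eta \o iota)).
move/de => Wg W W0 WD WS; apply: Wg => // _ [h /di Wh ->].
apply: (Wh (fun h => W (map_mpoly eta h))).
- by rewrite rmorph0.
- by move=> a x y Wx Wy; rewrite rmorphD /= map_mpolyZ; apply: WD.
- move=> _ [h' fh' ->]; apply: WS; exists h' => //.
  by rewrite (map_mpoly_comp_eq (c := eta \o iota)).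
Qed.

(** The Vandermonde weights recover each [h b] from the sums, and integral elements
    are stable under linear combinations. *)
Lemma vandermonde_integral (n : nat) (M : fieldType) (f : {mpoly M[n]}) (I : finType)
    (m : nat) (kappa : I -> 'I_m) (kappa_inj : injective kappa)
    (c : 'I_m -> M) (c_inj : injective c) (h : I -> {mpoly M[n]}) :
  (forall i, integralOver (horner_alg f) (\sum_b c i ^+ kappa b *: h b)) ->
  forall b, integralOver (horner_alg f) (h b).
Proof.
move=> f_int b; have [w Dw] := interpolation_weights c_inj (kappa b).
have -> : h b = \sum_i w i *: \sum_b' c i ^+ kappa b' *: h b'.
  under eq_bigr do rewrite scaler_sumr.
  rewrite exchange_big /= (eq_bigr (fun b' => (b' == b)%:R *: h b')) => [|b' _].
    rewrite (bigD1 b) //= big1 ?eqxx ?scale1r ?addr0 // => b' /negPf ->.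
    exact: scale0r.
  by under eq_bigr do rewrite scalerA; rewrite -scaler_suml Dw (inj_eq kappa_inj).
by apply: integral_sum => i; apply: integral_scale.
Qed.

(** The specialization argument common to all steps of the tower: [A] maps to the
    large field by [pi], and to a field integral over [k] by the [psi i], which
    turn the family [e] into distinct powers of distinct points. *)
Lemma integral_coefficients (n : nat) (k M : fieldType) (A K : comNzRingType)
    (iota : {rmorphism k -> A}) (pi : {rmorphism A -> K})
    (f : {mpoly k[n]}) (I : finType) (e : I -> A) (h : I -> {mpoly k[n]})
    (P : {poly {poly A}}) (P_monic : P \is monic)
    (Pg : root (map_poly (horner_alg (map_mpoly pi (map_mpoly iota f)))
                         (map_poly (map_poly pi) P))
               (map_mpoly pi (\sum_b e b *: map_mpoly iota (h b))))
    (j : {rmorphism k -> M}) (j_int : integralRange j)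
    (m : nat) (kappa : I -> 'I_m) (kappa_inj : injective kappa)
    (c : 'I_m -> M) (c_inj : injective c) (psi : 'I_m -> {rmorphism A -> M})
    (psi_iota : forall i a, psi i (iota a) = j a)
    (psi_ker : forall i a, pi a = 0 -> psi i a = 0)
    (psi_e : forall i b, psi i (e b) = c i ^+ kappa b) (b : I) :
  integralOver (horner_alg f) (h b).
Proof.
apply: (integral_descend j_int).
apply: (vandermonde_integral (h := fun b => map_mpoly j (h b)) kappa_inj c_inj) => i.
have := integral_specialize (psi_ker i) P_monic Pg.
rewrite (map_mpoly_comp_eq (c := j)) // rmorph_sum /=.
congr integralOver; apply: eq_bigr => b' _.
by rewrite map_mpolyZ psi_e (map_mpoly_comp_eq (c := j)).
Qed.

(** * Simple separable extensions *)

(** Minimality is expressed by divisibility, which is what specialization at a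
    conjugate needs. *)
Lemma ex_minimal_poly (E K : fieldType) (iota : {rmorphism E -> K}) (theta : K)
    (P : {poly E}) : P != 0 -> root (map_poly iota P) theta ->
  exists p : {poly E}, [/\ p != 0, root (map_poly iota p) theta
    & forall q, root (map_poly iota q) theta -> p %| q].
Proof.
have [N] := ubnP (size P); elim: N P => // N IH P ltPN P_neq0 Pt.
have [min|] := classic (forall q, root (map_poly iota q) theta -> P %| q).
  by exists P.
move=> /not_all_ex_not[q nq]; have [qt /negP Pq] := imply_to_and _ _ nq.
apply: (IH (q %% P)) => //; first by apply: leq_trans (ltnSE ltPN); rewrite ltn_modp.
move: qt; rewrite {1}(divp_eq q P) rmorphD rmorphM /root /= hornerD hornerM.
by rewrite (rootP Pt) mulr0 add0r.
Qed.

(** Here [A] is [E[X]], mapped to [K] by evaluation at [theta] and to a splitting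
    field of the minimal polynomial [p] by evaluation at the conjugates.
    Separability makes the number of conjugates equal to the degree of [p], which
    is also the number of powers of [theta] needed to write [g]. *)
Lemma separable_simple_descends (E K : fieldType) (iota : {rmorphism E -> K})
    (theta : K) (theta_gen : forall x, exists q, x = (map_poly iota q).[theta])
    (S : {poly E}) (S_sep : separable_poly S) (S_theta : root (map_poly iota S) theta) :
  integral_descends iota.
Proof.
have [p [p_neq0 p_theta p_min]] := ex_minimal_poly (separable_poly_neq0 S_sep) S_theta.
have p_sep : separable_poly p by apply: dvdp_separable S_sep; apply: p_min.
have [M [j [c [j_int c_inj c_root]]]] := ex_separable_splitting p_sep.
pose pi : {rmorphism {poly E} -> K} := horner_eval theta \o map_poly iota.
pose psi i : {rmorphism {poly E} -> M} := horner_eval (c i) \o map_poly j.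
move=> n f g [P P_monic Pg].
have [|h Dg] := @mpoly_decompose n _ _ iota 'I_(size p).-1 (fun l => theta ^+ l) g.
  move=> m; have [q ->] := theta_gen g@_m; exists (fun l : 'I_(size p).-1 => (q %% p)`_l).
  rewrite {1}(divp_eq q p) rmorphD rmorphM /= hornerD hornerM (rootP p_theta).
  rewrite mulr0 add0r (@horner_coef_wide _ (size p).-1).
    by apply: eq_bigr => l _; rewrite coef_map mulrC.
  by rewrite size_map_poly -ltnS prednK ?size_poly_gt0 // ltn_modp.
have [|Q Q_monic DP] := @monic_lift _ _ (map_poly pi) P P_monic.
  move=> i; apply: poly_lift => l; have [q ->] := theta_gen P`_i`_l.
  by exists q.
rewrite Dg; apply: spanned_sum => b; apply: spannedZ; apply: spanned_mem.
exists (h b) => //.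
have pi_iota x : pi (x%:P) = iota x by rewrite /= /horner_eval map_polyC hornerC.
pose C : {rmorphism E -> {poly E}} := polyC.
have piC (h' : {mpoly E[n]}) : map_mpoly pi (map_mpoly C h') = map_mpoly iota h'.
  exact: map_mpoly_comp_eq.
apply: (@integral_coefficients n E M {poly E} K C pi f _
  (fun l : 'I_(size p).-1 => 'X^l) h Q Q_monic _ j j_int _ id (@inj_id _) c c_inj psi).
- rewrite piC DP; congr (root _ _): Pg.
  rewrite Dg rmorph_sum /=; apply: eq_bigr => l _.
  by rewrite map_mpolyZ piC /= /horner_eval map_polyXn hornerXn.
- by move=> i x; rewrite /= /horner_eval map_polyC hornerC.
- move=> i q /eqP qt; have /dvdpP[r ->] := p_min q qt.
  by rewrite rmorphM /= {2}/horner_eval (rootP (c_root i)) mulr0.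
- by move=> i l; rewrite /= /horner_eval map_polyXn hornerXn.
Qed.

(** Intermediate fields are built as abstract fields mapped to [L], one generator
    at a time; a generator separable over [E] stays so over larger fields. *)
Lemma ex_separable_tower (E L : fieldType) (j : {rmorphism E -> L}) (s : seq L) :
  (forall x, x \in s -> exists2 P, separable_poly P & root (map_poly j P) x) ->
  exists (E' : fieldType) (iota : {rmorphism E -> E'}) (j' : {rmorphism E' -> L}),
    [/\ integral_descends iota, forall a, j' (iota a) = j a
      & forall x, x \in s -> exists y, j' y = x].
Proof.
elim: s E j => [|x s IHs] E j s_sep.
  by exists E, idfun, j; split=> //; apply: integral_descends_id.
have [|P P_sep Px] := s_sep x; first exact: mem_head.
have P_neq0 := separable_poly_neq0 P_sep.
pose E1 := subFExtend j x P.
pose i1 : {rmorphism E -> E1} := inj_subfx j x P.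
pose j1 : {rmorphism E1 -> L} := @subfx_inj _ _ j x P.
have j1i1 a : j1 (i1 a) = j a.
  by rewrite /= subfx_inj_eval // map_polyC hornerC.
have [|E2 [i2 [j2 [d2 j2i2 s2]]]] := IHs E1 j1.
  move=> y sy; have [|Q Q_sep Qy] := s_sep y; first by rewrite inE sy orbT.
  exists (map_poly i1 Q); first by rewrite separable_map.
  by rewrite -map_poly_comp (eq_map_poly j1i1).
exists E2, (i2 \o i1), j2; split=> [| a | y].
- apply: integral_descends_comp d2.
  apply: (@separable_simple_descends _ _ i1 (subfx_root j x P) _ P) => //.
    move=> y; have [q ->] := subfxE y; exists q.
    apply: (fmorph_inj j1); rewrite -horner_map /= subfx_inj_root // subfx_inj_eval //.
    by rewrite -map_poly_comp (eq_map_poly j1i1).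
  rewrite -(fmorph_root j1) -map_poly_comp (eq_map_poly j1i1) /=.
  by rewrite subfx_inj_root.
- by rewrite /= j2i2 j1i1.
- rewrite inE => /orP[/eqP -> | /s2 //].
  by exists (i2 (subfx_root j x P)); rewrite j2i2 /= subfx_inj_root.
Qed.

(** * Fields of rational functions *)

Lemma base_expansion_inj (B r : nat) (a b : 'I_r -> nat) :
  (forall i, a i < B)%N -> (forall i, b i < B)%N ->
  (\sum_i a i * B ^ i = \sum_i b i * B ^ i)%N -> a =1 b.
Proof.
elim: r a b => [|r IH] a b a_lt b_lt; first by move=> _ [].
have B_gt0 : (0 < B)%N by apply: leq_ltn_trans (a_lt ord0).
have sumE (x : 'I_r.+1 -> nat) :
    (\sum_i x i * B ^ i = (\sum_i x (lift ord0 i) * B ^ i) * B + x ord0)%N.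
  rewrite big_ord_recl muln1 addnC big_distrl /=; congr addn.
  by apply: eq_bigr => i _; rewrite expnS mulnCA mulnC.
rewrite !sumE => eq_ab.
have eq0 : a ord0 = b ord0.
  by have := congr1 (modn^~ B) eq_ab; rewrite !modnMDl !modn_small.
have eqS : (fun i => a (lift ord0 i)) =1 (fun i => b (lift ord0 i)).
  apply: IH => [i|i|]; [exact: a_lt | exact: b_lt |].
  by apply/eqP; rewrite -(eqn_pmul2r B_gt0) -(eqn_add2r (a ord0)) {2}eq0 eq_ab.
by move=> i; have [l ->|->//] := unliftP ord0 i; apply: eqS.
Qed.

(** The map [delta] sees [A] as constants of [R]: with [R] the polynomials over
    [A], the same notion speaks of common denominators of all coefficients. *)
Definition clears_denominators (A R S : comNzRingType) (delta : {rmorphism A -> R})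
    (a : {rmorphism R -> S}) : Prop :=
  forall x : S, exists d y, d != 0 /\ a (delta d) * x = a y.

Lemma clears_poly (A : idomainType) (R S : comNzRingType) (delta : {rmorphism A -> R})
    (a : {rmorphism R -> S}) :
  clears_denominators delta a -> clears_denominators (polyC \o delta) (map_poly a).
Proof.
move=> clr; elim/poly_ind => [|p x [d [y [d_neq0 Dy]]]].
  by exists 1, 0; rewrite mulr0 rmorph0 oner_neq0.
have [e [z [e_neq0 Dz]]] := clr x.
exists (d * e), ((delta e)%:P * y * 'X + (delta d * z)%:P); split.
  by rewrite mulf_neq0.
move: Dy; rewrite /= !map_polyC /= => Dy.
rewrite rmorphD !rmorphM /= map_polyX !map_polyC /= -Dy ?rmorphM /= -Dz ?rmorphM /=.
by ring.
Qed.

Lemma clears_mpoly (A : idomainType) (n : nat) (R S : comNzRingType)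
    (delta : {rmorphism A -> R}) (a : {rmorphism R -> S}) :
  clears_denominators delta a ->
  clears_denominators (@mpolyC n R \o delta) (map_mpoly a).
Proof.
move=> clr; elim/mpolyind => [|x m p _ _ [d [y [d_neq0 Dy]]]].
  by exists 1, 0; rewrite mulr0 rmorph0 oner_neq0.
have [e [z [e_neq0 Dz]]] := clr x.
exists (d * e), ((delta d * z) *: 'X_[m] + (delta e)%:MP * y); split.
  by rewrite mulf_neq0.
move: Dy; rewrite /= !map_mpolyC /= => Dy.
rewrite rmorphD !rmorphM /= map_mpolyZ map_mpolyX !map_mpolyC /= -Dy.
rewrite -!mul_mpolyC ?rmorphM /= -Dz ?rmorphM /=.
by ring.
Qed.

(** The monic equation of [D * x], written so that only [D * P`_i] and powers of
    [D] appear: with [D] a common denominator, it has no denominators. *)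
Lemma scale_root (T : comNzRingType) (P : {poly T}) (x D : T) (N := (size P).-1) :
  P \is monic -> root P x ->
  root ('X^N + \poly_(i < N) (D ^+ (N - i.+1) * (D * P`_i))) (D * x).
Proof.
move=> P_monic Px; rewrite /root hornerD hornerXn horner_poly.
have sP : size P = N.+1 by rewrite /N prednK // size_poly_gt0 monic_neq0.
suff -> : (D * x) ^+ N + \sum_(i < N) D ^+ (N - i.+1) * (D * P`_i) * (D * x) ^+ i
          = D ^+ N * P.[x] by rewrite (rootP Px) mulr0.
rewrite horner_coef sP big_ord_recr /= mulrDr mulr_sumr addrC; congr (_ + _).
  apply: eq_bigr => i _; rewrite exprMn mulrA -exprSr !mulrA -subSn // subSS.
  have -> : D ^+ N = D ^+ (N - i) * D ^+ i by rewrite -exprD subnK // ltnW.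
  by ring.
have -> : P`_N = 1 by have := monicP P_monic; rewrite lead_coefE.
by rewrite mul1r exprMn.
Qed.

(** The common denominator is absorbed into [g] and into its integral equation,
    which then lives over [A = k[t]]; there the monomials of degree below [B]
    are told apart by the Kronecker substitution [t_l := c ^ (B ^ l)]. *)
Lemma fraction_descends (k : fieldType) (r : nat) (K : fieldType)
    (pi : {rmorphism {mpoly k[r]} -> K}) (pi_inj : injective pi)
    (pi_frac : clears_denominators idfun pi) :
  integral_descends (pi \o @mpolyC r k).
Proof.
move=> n f g [P P_monic Pg].
pose A := {mpoly k[r]}; pose N := (size P).-1.
have [d1 [Q [d1_neq0 DQ]]] := clears_poly (clears_poly pi_frac) P.
have [d2 [G [d2_neq0 DG]]] := clears_mpoly pi_frac g.
rewrite /= !map_polyC /= in DQ; rewrite /= map_mpolyC /= in DG.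
(* A single denominator serves both for the equation and for g. *)
pose d : A := d1 * d2.
have d_neq0 : d != 0 by rewrite mulf_neq0.
pose G' := d1%:MP * G.
have DG' : map_mpoly pi G' = (pi d)%:MP * g.
  by rewrite rmorphM /= map_mpolyC -DG mulrA -!rmorphM.
pose Q' : {poly {poly A}} :=
  'X^N + \poly_(i < N) (d%:P ^+ (N - i.+1) * (d2%:P * Q`_i)).
have Q'_monic : Q' \is monic.
  by rewrite monicE lead_coefDl ?size_polyXn ?ltnS ?size_poly // lead_coefXn.
pose iota : {rmorphism k -> A} := @mpolyC r k.
have piC (h : {mpoly k[n]}) : map_mpoly pi (map_mpoly iota h) = map_mpoly (pi \o iota) h.
  exact: map_mpoly_comp_eq.
have Q'G' : root (map_poly (horner_alg (map_mpoly pi (map_mpoly iota f)))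
                    (map_poly (map_poly pi) Q')) (map_mpoly pi G').
  rewrite piC DG'; set F := map_mpoly _ f in Pg *.
  have [H HE] : exists H : {rmorphism {poly A} -> {mpoly K[n]}},
      forall q, H q = horner_alg F (map_poly pi q).
    by exists (horner_alg F \o map_poly pi).
  have HC x : H x%:P = (pi x)%:MP by rewrite HE map_polyC; exact: horner_alg_mpolyC.
  have HQ i : H Q`_i = (pi d1)%:MP * horner_alg F P`_i.
    by rewrite HE -[map_poly pi _]coef_map -DQ coefCM rmorphM; congr (_ * _); rewrite -HC HE.
  have := scale_root (pi d)%:MP (monic_map (horner_alg F) P_monic) Pg.
  congr (root _ _).
  have -> : (size (map_poly (horner_alg F) P)).-1 = N.
    by rewrite size_map_poly_id0 // (monicP P_monic) rmorph1 oner_neq0.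
  rewrite !rmorphD /= !map_polyXn; congr (_ + _); apply/polyP => i.
  rewrite [LHS]coef_poly [RHS]coef_map /= [X in horner_alg F X]coef_map /=.
  rewrite [X in map_poly pi X]coef_poly.
  case: ifP => _; last by rewrite !raddf0.
  rewrite -HE [H _]rmorphM [H (_ ^+ _)]rmorphXn [H (_ * _)]rmorphM HQ !HC.
  rewrite [X in _ * (_ * X) = _]coef_map.
  by rewrite !rmorphM /=; congr (_ * _); ring.
pose B := \max_(m <- msupp G') msize G'@_m.
have G'B m : (msize G'@_m <= B)%N.
  have [|/memN_msupp_eq0 ->] := boolP (m \in msupp G'); last by rewrite msize0.
  by move=> Gm; exact: leq_bigmax_seq.
pose I : finType := 'X_{1..r < B}.
have [|h Dh] := @mpoly_decompose n _ _ iota I (fun b => 'X_[b]) G'.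
  move=> m; exists (fun b : I => G'@_m@_b); rewrite {1}(mpolywE (G'B m)).
  by apply: eq_bigr => b _; rewrite mulrC mul_mpolyC.
(* The exponent of c in the image of a monomial: a number in base B. *)
pose kappa0 (b : I) : nat := (\sum_(l < r) b l * B ^ l)%N.
have kappa0_inj : injective kappa0.
  move=> b b'; have bB (x : I) l : (x l < B)%N.
    by apply: leq_ltn_trans (bmdeg x); rewrite mdegE (bigD1 l) //= leq_addr.
  by move/(base_expansion_inj (bB b) (bB b')) => eq_b; apply/val_inj/mnmP.
have [M [j [m [c [le_m j_int c_inj]]]]] := ex_many_points k (\max_b kappa0 b).+1.
have kappa_lt b : (kappa0 b < m)%N.
  by apply: leq_trans le_m; rewrite ltnS; apply: leq_bigmax.
pose kappa b := Ordinal (kappa_lt b).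
have kappa_inj : injective kappa by move=> b b' [] /kappa0_inj.
pose psi i : {rmorphism A -> M} := mmap j (fun l : 'I_r => c i ^+ (B ^ l)).
have h_int b : integralOver (horner_alg f) (h b).
  apply: (@integral_coefficients n k M A K iota pi f I (fun b => 'X_[b]) h Q' Q'_monic _
    j j_int m kappa kappa_inj c c_inj psi).
  - by rewrite -Dh.
  - by move=> i x; rewrite /= mmapC.
  - by move=> i x; rewrite -(rmorph0 pi) => /pi_inj ->; rewrite rmorph0.
  - move=> i b'; rewrite /= mmapX /mmap1 /kappa0 -prodrXr /=.
    by apply: eq_bigr => l _; rewrite -exprM mulnC.
have pid_neq0 : pi d != 0 by rewrite -(rmorph0 pi) (inj_eq pi_inj).
have -> : g = (pi d)^-1 *: map_mpoly pi G'.
  by rewrite DG' mul_mpolyC scalerA mulVf // scale1r.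
rewrite Dh rmorph_sum; apply: spannedZ; apply: spanned_sum => b /=.
rewrite map_mpolyZ piC; apply: spannedZ; apply: spanned_mem.
by exists (h b).
Qed.

Lemma frac_reprE (A : idomainType) (x : {fraction A}) :
  FracField.tofrac \d_(repr x) * x = FracField.tofrac \n_(repr x).
Proof.
rewrite -{2}[x]reprK; move: (repr x) => y; apply/eqP.
rewrite !piE /= equivfE /FracField.mulf !numden_Ratio ?mulf_neq0 ?denom_ratioP ?oner_neq0 //.
by rewrite !mul1r mulr1.
Qed.

(** The value at [x] does not depend on the chosen representative of [x], by
    injectivity ([JE] in the proof); each identity is then checked on the obvious
    fraction. *)
Lemma fraction_lift (A : idomainType) (L : fieldType) (phi : {rmorphism A -> L}) :
  injective phi ->
  exists J : {rmorphism {fraction A} -> L}, forall a, J (FracField.tofrac a) = phi a.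
Proof.
move=> phi_inj.
have phi_neq0 a : a != 0 -> phi a != 0 by rewrite -(rmorph0 phi) (inj_eq phi_inj).
pose J (x : {fraction A}) : L := phi \n_(repr x) / phi \d_(repr x).
have d_neq0 (x : {fraction A}) : \d_(repr x) != 0 := denom_ratioP _.
have JE d a x : d != 0 -> FracField.tofrac d * x = FracField.tofrac a -> J x = phi a / phi d.
  move=> nz_d dx; apply/eqP; rewrite eqr_div ?phi_neq0 // -!rmorphM (inj_eq phi_inj).
  by rewrite -tofrac_eq !tofracM -dx -frac_reprE; apply/eqP; ring.
have J_zmod : zmod_morphism J.
  move=> x y; have [dx dy] := (frac_reprE x, frac_reprE y).
  rewrite (JE (\d_(repr x) * \d_(repr y))
              (\n_(repr x) * \d_(repr y) - \n_(repr y) * \d_(repr x))).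
  - by rewrite /J rmorphB !rmorphM /=; field; rewrite !phi_neq0 ?d_neq0.
  - by rewrite mulf_neq0.
  - by rewrite tofracB !tofracM -dx -dy; ring.
have J_monoid : monoid_morphism J.
  split=> [|x y]; first by rewrite (JE 1 1) ?divff ?phi_neq0 ?oner_neq0 ?mulr1.
  have [dx dy] := (frac_reprE x, frac_reprE y).
  rewrite (JE (\d_(repr x) * \d_(repr y)) (\n_(repr x) * \n_(repr y))).
  - by rewrite /J !rmorphM /=; field; rewrite !phi_neq0 ?d_neq0.
  - by rewrite mulf_neq0.
  - by rewrite !tofracM -dx -dy; ring.
pose JZ := GRing.isZmodMorphism.Build _ _ J J_zmod.
pose JM := GRing.isMonoidMorphism.Build _ _ J J_monoid.
pose J' : {rmorphism {fraction A} -> L} := HB.pack J JZ JM.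
exists J' => a; rewrite /= (JE 1 a) ?oner_neq0 ?tofrac1 ?mul1r //.
by rewrite rmorph1 divr1.
Qed.

(** Algebraic independence makes evaluation at [t] injective, so that the field of
    rational functions maps to [L] with image containing [k(t)]. *)
Lemma fraction_rational_functions (k L : fieldType) (iota : {rmorphism k -> L}) (t : seq L) :
  alg_independent iota t ->
  exists (F : fieldType) (eta : {rmorphism k -> F}) (J : {rmorphism F -> L}),
    [/\ integral_descends eta, forall a, J (eta a) = iota a
      & forall x, x \in t -> exists y, J y = x].
Proof.
move=> t_free.
pose A := {mpoly k[size t]}.
pose phi : {rmorphism A -> L} := mmap iota (fun i => t`_i).
have phi_inj : injective phi.
  move=> p q /eqP; rewrite -subr_eq0 -rmorphB => /eqP/t_free/eqP.
  by rewrite subr_eq0 => /eqP.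
have [J JE] := fraction_lift phi_inj.
pose pi : {rmorphism A -> {fraction A}} := @FracField.tofrac A.
exists {fraction A}, (pi \o @mpolyC (size t) k), J; split.
- apply: fraction_descends.
    by move=> a b /eqP; rewrite tofrac_eq => /eqP.
  move=> x; exists (\d_(repr x)), (\n_(repr x)); split; first exact: denom_ratioP.
  exact: frac_reprE.
- by move=> a; rewrite /= JE /phi /= mmapC.
- move=> x /(nthP 0)[i lt_i <-]; exists (pi 'X_(Ordinal lt_i)).
  by rewrite JE /phi /= mmapX mmap1U.
Qed.

(** * Separable extensions *)

(** With the minimality of [adjoin], this puts every element of an adjoined field in
    the image of any field that reaches its generators. *)
Lemma image_subfield (F L : fieldType) (J : {rmorphism F -> L}) :
  is_subfield (fun x => exists y, J y = x).
Proof.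
split; first by exists 1; rewrite rmorph1.
  by move=> _ _ [x <-] [y <-]; exists (x - y); rewrite rmorphB.
by move=> _ _ [x <-] [y <-]; exists (x / y); rewrite fmorph_div.
Qed.

(** Only the finitely many coefficients of [g] and of one integral equation matter;
    they lie in the top field [E] of a tower over the rational functions in a
    separating transcendence basis. *)
Lemma separable_descends (k L : fieldType) (iota : {rmorphism k -> L}) :
  separable_extension iota -> integral_descends iota.
Proof.
move=> sep n f g [P P_monic Pg].
pose s := [seq g@_m | m <- msupp g] ++ flatten [seq polyseq p | p <- polyseq P].
have [t [_ t_free t_sep]] := sep s.
have [F [eta [J [eta_descends Jeta Jt]]]] := fraction_rational_functions t_free.
have [|E [theta [j [theta_descends jtheta js]]]] := @ex_separable_tower F L J s.
  move=> x sx; have [|p [_ p_over px _] p_sep] := t_sep x.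
    by move=> G _ _; apply.
  have [|q Dq] := @poly_lift _ _ J p.
    move=> i; apply: (p_over i) (image_subfield J) _ _; last exact: Jt.
    by move=> a; exists (eta a).
  by exists q; rewrite -?(separable_map J) Dq.
have im0 : exists y, j y = 0 by exists 0; rewrite rmorph0.
have [|h Dg] := @mpoly_decompose n _ _ j 'I_1 (fun=> 1) g.
  move=> m; suff [y Dy] : exists y, j y = g@_m.
    by exists (fun=> y); rewrite big_ord1 mul1r.
  have [gm | /memN_msupp_eq0 ->//] := boolP (m \in msupp g).
  by apply: js; rewrite mem_cat (map_f (fun m => g@_m) gm).
rewrite big_ord1 scale1r in Dg; move: (h _) Dg => g' Dg {h}.
have [|Q Q_monic DP] := @monic_lift _ _ (map_poly j) P P_monic.
  move=> i; apply: poly_lift => l.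
  have [lt_i | ge_i] := ltnP i (size P); last by rewrite (nth_default _ ge_i) coef0.
  have [lt_l | ge_l] := ltnP l (size P`_i); last by rewrite (nth_default _ ge_l).
  apply: js; rewrite mem_cat; apply/orP; right; apply/flattenP.
  by exists (polyseq P`_i); rewrite ?mem_nth //; apply: map_f; apply: mem_nth.
pose io := theta \o eta.
have jio (p : {mpoly k[n]}) : map_mpoly j (map_mpoly io p) = map_mpoly iota p.
  by apply: map_mpoly_comp_eq => a; rewrite /= jtheta Jeta.
have Qg : integralOver (horner_alg (map_mpoly io f)) g'.
  rewrite -(map_mpoly_idfun (map_mpoly io f)) -[g']map_mpoly_idfun.
  apply: (@integral_specialize n E L E j idfun _ (map_mpoly io f) g' Q Q_monic).
    by move=> a /eqP; rewrite fmorph_eq0 => /eqP.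
  by rewrite jio DP -Dg.
have /(_ n f g' Qg) g'_span := integral_descends_comp eta_descends theta_descends.
move=> W W0 WD WS; rewrite Dg.
apply: (g'_span (fun p => W (map_mpoly j p))).
- by rewrite rmorph0.
- by move=> a x y Wx Wy; rewrite rmorphD /= map_mpolyZ; apply: WD.
- by move=> _ [h fh ->]; rewrite jio; apply: WS; exists h.
Qed.

(** * Closedness in both directions *)

Lemma closed_mpoly_extends (k L : fieldType) (iota : {rmorphism k -> L}) (n : nat)
    (f : {mpoly k[n]}) :
  integral_descends iota -> closed_mpoly f -> closed_mpoly (map_mpoly iota f).
Proof.
move=> iota_descends f_closed g /iota_descends; apply.
- by exists 0; rewrite rmorph0.
- move=> a _ _ [p ->] [q ->]; exists (a *: p + q).
  by rewrite rmorphD -mul_polyC rmorphM /= horner_alg_mpolyC mul_mpolyC.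
- move=> _ [h /f_closed[q ->] ->]; exists (map_poly iota q).
  by rewrite map_horner_alg.
Qed.

(** Solvability of a linear system does not depend on the field: inclusion of row
    spaces is unchanged under field morphisms.  The rows list the coefficients at
    the monomials of degree below a common bound. *)
Lemma linear_combination_descends (k L : fieldType) (iota : {rmorphism k -> L})
    (n N : nat) (h : 'I_N -> {mpoly k[n]}) (g : {mpoly k[n]}) (c : 'I_N -> L) :
  map_mpoly iota g = \sum_i c i *: map_mpoly iota (h i) ->
  exists u : 'I_N -> k, g = \sum_i u i *: h i.
Proof.
move=> Dg.
pose B := maxn (msize g) (\max_i msize (h i)).
have sg : (msize g <= B)%N by apply: leq_maxl.
have sh i : (msize (h i) <= B)%N.
  by apply: leq_trans (leq_maxr _ _); apply: (leq_bigmax i).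
pose I : finType := 'X_{1..n < B}.
pose A : 'M[k]_(N, #|I|) := \matrix_(i, a) (h i)@_(enum_val a : I).
pose v : 'rV[k]_#|I| := \row_a g@_(enum_val a : I).
have : (v <= A)%MS.
  rewrite -(map_submx iota); apply/submxP; exists (\row_i c i).
  apply/rowP => a; rewrite !mxE -mcoeff_map_rmorph Dg raddf_sum /=.
  by apply: eq_bigr => i _; rewrite !mxE mcoeffZ mcoeff_map_rmorph.
(* Coefficients outside I vanish, by the choice of B. *)
case/submxP => u Du; exists (fun i => u 0 i); apply/mpolyP => m.
rewrite raddf_sum /=; have [lt_mB | ge_mB] := ltnP (mdeg m) B; last first.
  rewrite memN_msupp_eq0 ?msize_mdeg_ge ?(leq_trans sg) // big1 // => i _.
  by rewrite mcoeffZ memN_msupp_eq0 ?mulr0 // msize_mdeg_ge ?(leq_trans (sh i)).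
have /rowP/(_ (enum_rank (BMultinom lt_mB : I))) := Du.
rewrite !mxE enum_rankK => ->; apply: eq_bigr => i _.
by rewrite mxE enum_rankK mcoeffZ.
Qed.

Lemma closed_mpoly_descends (k L : fieldType) (iota : {rmorphism k -> L}) (n : nat)
    (f : {mpoly k[n]}) :
  closed_mpoly (map_mpoly iota f) -> closed_mpoly f.
Proof.
move=> f_closed g fg; have [q Dq] := f_closed _ (integral_map iota fg).
have [|u Du] := @linear_combination_descends _ _ iota n (size q) (fun i => f ^+ i) g
  (fun i => q`_i).
  by rewrite Dq (horner_alg_sum _ (leqnn _)); apply: eq_bigr => i _; rewrite rmorphXn.
exists (\poly_(i < size q) (if insub i is Some i' then u i' else 0)).
rewrite (horner_alg_sum _ (size_poly _ _)) Du; apply: eq_bigr => i _.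
by rewrite coef_poly ltn_ord valK.
Qed.

Theorem proposition2 (k L : fieldType) (iota : {rmorphism k -> L})
    (sep : separable_extension iota) (n : nat) (f : {mpoly k[n]})
    (f_nonconst : forall c : k, f <> c%:MP_[n]) :
  closed_mpoly f <-> closed_mpoly (map_mpoly iota f).
Proof.
split; last exact: closed_mpoly_descends.
exact: closed_mpoly_extends (separable_descends sep).
Qed.
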